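(* Let $F$ be a field of characteristic $2$, and let $p$ and $q$ be anisotropic quasilinear quadratic forms of dimension $\geq 2$ over $F$. If $q_{F(p)}$ is isotropic, then $p_1$ is similar to a subform of $(q_{F(p)})_{\mathrm{an}}$.
   Context: Quasilinear form (char $2$): an additive quadratic form, equivalently $\langle a_1,\dots,a_n\rangle:(\lambda_i)\mapsto\sum a_i\lambda_i^2$. For quasilinear $\phi$, the isotropic vectors form a subspace $U$ and the anisotropic part $\phi_{\mathrm{an}}$ is the induced form on $V_\phi/U$. $F(p)$ is the function field of the projective quadric $\{p=0\}$, and $p_1:=(p_{F(p)})_{\mathrm{an}}$ is the first higher anisotropic kernel of $p$. A subform of $\phi$ is a form $\rho$ with $\phi\simeq\rho\perp r$; forms are similar if one is isometric to a nonzero scalar multiple of the other. *)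

(* Defs.v *)
From HB Require Import structures.
From mathcomp Require Import all_boot all_order all_algebra.
From mathcomp Require Import mpoly.
Set Implicit Arguments. Unset Strict Implicit. Unset Printing Implicit Defensive.
Import GRing.Theory.
Local Open Scope ring_scope.

Section Forms.
Variable F : fieldType.

(* The polar form of an additive map is zero, so bilinearity of the polar
   form, part of the definition of a quadratic form, holds automatically. *)
Definition quasilinear (V : vectType F) (q : V -> F) : Prop :=
  (forall u v, q (u + v) = q u + q v) /\
  (forall a v, q (a *: v) = a ^+ 2 * q v).

Definition isotropic (V : vectType F) (q : V -> F) : Prop :=
  exists2 v, v != 0 & q v = 0.

Definition anisotropic (V : vectType F) (q : V -> F) : Prop :=
  ~ isotropic q.

Definition isometric (V W : vectType F) (phi : V -> F) (psi : W -> F) : Prop :=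
  exists f : {linear V -> W}, bijective f /\ forall v, psi (f v) = phi v.

Definition orth_sum (V W : vectType F) (phi : V -> F) (psi : W -> F) :
  (V * W)%type -> F := fun x => phi x.1 + psi x.2.

Definition subform (U V : vectType F) (rho : U -> F) (phi : V -> F) : Prop :=
  exists (W : vectType F) (r : W -> F),
    quasilinear r /\ isometric phi (orth_sum rho r).

Definition similar_forms (V W : vectType F) (phi : V -> F) (psi : W -> F) : Prop :=
  exists2 c : F, c != 0 & isometric phi (fun w => c * psi w).

(* The space W, with the projection pi, is the quotient of V by the subspace
   of isotropic vectors of phi, and psi is the form induced by phi on it. *)
Definition anisotropic_part (V W : vectType F) (phi : V -> F) (psi : W -> F) :
  Prop :=
  exists pi : {linear V -> W},
    [/\ forall w, exists v, pi v = w,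
        forall v, pi v = 0 <-> phi v = 0
      & forall v, psi (pi v) = phi v].

(* q is <a_1, ..., a_n> in the basis (vbasis {:V}), with a_i = ql_coef q i. *)
Definition ql_coef (V : vectType F) (q : V -> F) (i : 'I_(\dim {:V})) : F :=
  q (vbasis {:V})`_i.

Lemma ql_coefE (V : vectType F) (q : V -> F) (v : V) : quasilinear q ->
  q v = \sum_i ql_coef q i * coord (vbasis {:V}) i v ^+ 2.
Proof.
move=> [qD qZ].
have q0 : q 0 = 0 by rewrite -(scale0r (0 : V)) qZ expr0n mul0r.
rewrite {1}(coord_vbasis (memvf v)) (big_morph q qD q0).
by apply: eq_bigr => i _; rewrite qZ mulrC.
Qed.

Definition ql_poly (V : vectType F) (q : V -> F) : {mpoly F[\dim {:V}]} :=
  \sum_i ql_coef q i *: 'X_i ^+ 2.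

(* The scalar extension of V is 'rV[K]_(\dim {:V}), by means of the basis
   (vbasis {:V}). *)
Definition base_change (K : fieldType) (iota : {rmorphism F -> K})
    (V : vectType F) (q : V -> F) : 'rV[K]_(\dim {:V}) -> K :=
  fun x => \sum_i iota (ql_coef q i) * x 0 i ^+ 2.

(* K, an extension of F through iota, is the function field of the integral
   projective hypersurface {P = 0} (P homogeneous): it has a point x, given by
   homogeneous coordinates, at which exactly the homogeneous multiples of P
   vanish, so that f / g |-> f(x) / g(x) embeds in K the field of fractions of
   degree 0 of the graded ring F[X_1, ..., X_n] / (P), and this embedding is
   onto. This determines K up to isomorphism over F. *)
Definition is_function_field (n : nat) (P : {mpoly F[n]})
    (K : fieldType) (iota : {rmorphism F -> K}) : Prop :=
  exists x : 'I_n -> K,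
    [/\ exists i, x i != 0,
        forall (d : nat) (f : {mpoly F[n]}), f \is d.-homog ->
          (mmap iota x f = 0 <-> exists g, f = g * P)
      & forall z : K, exists (d : nat) (f g : {mpoly F[n]}),
          [/\ f \is d.-homog, g \is d.-homog, mmap iota x g != 0
            & z = mmap iota x f / mmap iota x g]].

End Forms.

(* Main.v *)
(* Write p = <a_1, ..., a_n>, q = <b_1, ..., b_m>, P = \sum a_i X_i^2, and let x
   be the generic point of {P = 0}. Clearing denominators in an isotropic vector
   of q over K gives homogeneous polynomials h_j, not all zero at x, and g with
   \sum b_j h_j^2 = g P. If g vanished at x, then P^2 would divide
   \sum b_j h_j^2; as the b_j are free over F^2, it would divide every h_j^2,
   which is impossible. Hence c = g(x) is nonzero. Evaluating the identity at
   x + eps e_i and comparing the coefficients of eps^2 gives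
   c a_i = \sum b_j t_ij^2, with t_ij = (dh_j / dX_i)(x), so that the matrix
   (t_ij) defines a linear map T with q_K(T e) = c p_K(e). Modulo isotropic
   vectors, T becomes an injection that maps c p_1 isometrically into q_1. *)
Require Import Defs.
From HB Require Import structures.
From mathcomp Require Import all_boot all_order all_algebra.
From mathcomp Require Import mpoly.
Set Implicit Arguments. Unset Strict Implicit. Unset Printing Implicit Defensive.
Import GRing.Theory.
Local Open Scope ring_scope.

(** * Squares and divisibility in characteristic 2 *)

Lemma sqrD_pchar2 (R : comNzRingType) : 2%N \in [pchar R] ->
  {morph (fun x : R => x ^+ 2) : x y / x + y}.
Proof.
by move=> R2 x y; rewrite -!(pFrobenius_autE R2) rmorphD.
Qed.

Lemma sqr_sum_pchar2 (R : comNzRingType) (I : Type) (r : seq I) (P : pred I)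
    (f : I -> R) : 2%N \in [pchar R] ->
  (\sum_(i <- r | P i) f i) ^+ 2 = \sum_(i <- r | P i) f i ^+ 2.
Proof.
by move=> R2; apply: (big_morph (fun x => x ^+ 2) (sqrD_pchar2 R2)); rewrite expr0n.
Qed.

Section SquareCoefficients.
Variables (F : fieldType) (n : nat).
Hypothesis F2 : 2%N \in [pchar F].
Implicit Types g h : {mpoly F[n]}.

(** The ring F^2[X_1, ..., X_n]. It contains all squares and also all monomials, so leading terms
    can be split off inside it. *)
Definition sq_coefs g : Prop := forall m, exists s, g@_m = s ^+ 2.

Lemma sq_coefsD g h : sq_coefs g -> sq_coefs h -> sq_coefs (g + h).
Proof.
move=> sg sh m; have [[s gm] [t hm]] := (sg m, sh m).
by exists (s + t); rewrite mcoeffD gm hm sqrD_pchar2.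
Qed.

Lemma sq_coefs_sum (I : Type) (r : seq I) (P : pred I) (f : I -> {mpoly F[n]}) :
  (forall i, P i -> sq_coefs (f i)) -> sq_coefs (\sum_(i <- r | P i) f i).
Proof.
move=> sf; apply: (big_ind sq_coefs) => //; last exact: sq_coefsD.
by move=> m; exists 0; rewrite mcoeff0 expr0n.
Qed.

Lemma sq_coefsM g h : sq_coefs g -> sq_coefs h -> sq_coefs (g * h).
Proof.
move=> sg sh m; rewrite mcoeffM.
apply: (big_ind (fun x => exists s, x = s ^+ 2)).
- by exists 0; rewrite expr0n.
- by move=> _ _ [s ->] [t ->]; exists (s + t); rewrite sqrD_pchar2.
- move=> k _; have [[s ->] [t ->]] := (sg k.1, sh k.2).
  by exists (s * t); rewrite exprMn.
Qed.

Lemma sq_coefs_sqrZX s m : sq_coefs (s ^+ 2 *: 'X_[m]).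
Proof.
move=> k; rewrite mcoeffZ mcoeffX; case: eqP => _.
  by exists s; rewrite mulr1.
by exists 0; rewrite mulr0 expr0n.
Qed.

Lemma sq_coefs_sqr g : sq_coefs (g ^+ 2).
Proof.
have M2 : 2%N \in [pchar {mpoly F[n]}] by rewrite pchar_lalg.
rewrite [g]mpolyE sqr_sum_pchar2 //; apply: sq_coefs_sum => m _.
by rewrite exprZn mpolyXn; apply: sq_coefs_sqrZX.
Qed.

Variables (l : nat) (b : 'I_l -> F).

(** The F^2[X_1, ..., X_n]-submodule generated by the [b j]. *)
Definition sq_span g : Prop :=
  exists2 gam : 'I_l -> {mpoly F[n]},
    forall j, sq_coefs (gam j) & g = \sum_j b j *: gam j.

Lemma sq_span0 : sq_span 0.
Proof.
exists (fun=> 0); last by rewrite big1 // => j _; rewrite scaler0.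
by move=> j m; exists 0; rewrite mcoeff0 expr0n.
Qed.

Lemma sq_spanD g h : sq_span g -> sq_span h -> sq_span (g + h).
Proof.
move=> [gam sgam ->] [del sdel ->]; exists (fun j => gam j + del j).
  by move=> j; apply: sq_coefsD.
by rewrite -big_split; apply: eq_bigr => j _; rewrite scalerDr.
Qed.

Lemma sq_spanMl r g : sq_coefs r -> sq_span g -> sq_span (r * g).
Proof.
move=> sr [gam sgam ->]; exists (fun j => r * gam j).
  by move=> j; apply: sq_coefsM.
by rewrite mulr_sumr; apply: eq_bigr => j _; rewrite scalerAr.
Qed.

(* The leading coefficient of g lies in the span of the b j over the squares,
   since that of r is a square; subtract the leading term and iterate. *)
Lemma sq_span_div r g : r != 0 -> sq_coefs r -> sq_span (r * g) -> sq_span g.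
Proof.
move=> r0 sr; elim/mleadrect: g => g IH span_rg.
have [->|g0] := eqVneq g 0; first exact: sq_span0.
have [gam sgam rg] := span_rg.
have [t rt] := sr (mlead r).
have t0 : t != 0.
  by move: r0; rewrite -mleadc_eq0 rt; apply: contraNneq => ->; rewrite expr0n.
have [s gams] := fin_all_exists (fun j => sgam j (mlead r + mlead g)%MM).
have lc_g : g@_(mlead g) = \sum_j b j * (s j / t) ^+ 2.
  apply: (mulfI (expf_neq0 2 t0)); rewrite -{1}rt -mleadcM rg raddf_sum mulr_sumr.
  apply: eq_bigr => j _ /=; rewrite mcoeffZ gams [RHS]mulrCA; congr (_ * _).
  rewrite [t ^+ 2 * _]mulrC expr_div_n. by rewrite divfK ?expf_neq0.
pose top := g@_(mlead g) *: 'X_[mlead g].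
have span_top : sq_span top.
  exists (fun j => (s j / t) ^+ 2 *: 'X_[mlead g]).
    by move=> j; apply: sq_coefs_sqrZX.
  by rewrite /top lc_g scaler_suml; apply: eq_bigr => j _; rewrite scalerA.
suff span_rest : sq_span (g - top) by rewrite -(subrK top g); apply: sq_spanD.
have [->|rest0] := eqVneq (g - top) 0; first exact: sq_span0.
apply: IH; first exact: ltm_mleadD.
have M2 : 2%N \in [pchar {mpoly F[n]}] by rewrite pchar_lalg.
rewrite mulrBr -mulrN (oppr_pchar2 M2).
by apply: sq_spanD => //; apply: sq_spanMl.
Qed.

Hypothesis b_free :
  forall s : 'I_l -> F, \sum_j b j * s j ^+ 2 = 0 -> forall j, s j = 0.

(** Freeness over F^2 passes to F^2[X_1, ..., X_n] one monomial at a time. *)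
Lemma sq_span_free (gam : 'I_l -> {mpoly F[n]}) :
  (forall j, sq_coefs (gam j)) -> \sum_j b j *: gam j = 0 -> forall j, gam j = 0.
Proof.
move=> sgam gam0 j; apply/mpolyP => m; rewrite mcoeff0.
have [s gams] := fin_all_exists (fun j => sgam j m).
rewrite gams (b_free (s := s)) ?expr0n //.
rewrite -[RHS](mcoeff0 F m) -gam0 raddf_sum.
by apply: eq_bigr => k _; rewrite /= mcoeffZ gams.
Qed.

(** By [sq_span_div], g is a combination of the [b j] with coefficients [gam j] over F^2; freeness
    allows comparing [h j ^+ 2] with [r ^+ 2 * gam j] for each j. *)
Lemma sqr_dvd_diag r g (h : 'I_l -> {mpoly F[n]}) : r != 0 ->
  \sum_j b j *: h j ^+ 2 = r ^+ 2 * g -> forall j, exists k, h j ^+ 2 = r ^+ 2 * k.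
Proof.
move=> r0 hr.
have sr : sq_coefs (r ^+ 2) by apply: sq_coefs_sqr.
have M2 : 2%N \in [pchar {mpoly F[n]}] by rewrite pchar_lalg.
have [||gam sgam g_gam] := sq_span_div (r := r ^+ 2) (g := g) _ sr.
- by rewrite expf_neq0.
- by rewrite -hr; exists (fun j => h j ^+ 2) => // j; apply: sq_coefs_sqr.
move=> j; exists (gam j); apply/eqP; rewrite -subr_eq0; apply/eqP.
apply: (sq_span_free (gam := fun j => h j ^+ 2 - r ^+ 2 * gam j)) => [i|].
  by rewrite (oppr_pchar2 M2); apply: sq_coefsD;
    [apply: sq_coefs_sqr | apply: sq_coefsM].
under eq_bigr do rewrite scalerBr [X in _ - X]scalerAr.
by rewrite sumrB -mulr_sumr -g_gam hr subrr.
Qed.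

End SquareCoefficients.

(** * Homogeneous cofactors and evaluation *)

Lemma homog_divisor (F : fieldType) (n d e : nat) (g P : {mpoly F[n]}) :
  P \is d.-homog -> g * P \is e.-homog ->
  exists2 h, h \is (e - d).-homog & g * P = h * P.
Proof.
move=> hP hgP; pose part i := pihomog mdeg i g.
(* Only the component of g in degree e - d contributes to g P in degree e. If e < d, the sum is
   empty and g P = 0, so the truncated [e - d] does no harm. *)
exists (\sum_(i < msize g | (i + d)%N == e) part i).
  by apply: rpred_sum => i /eqP <-; rewrite addnK; apply: pihomogP.
rewrite -{1}(pihomog_dE hgP) {1}(pihomog_partitionE (leqnn (mmeasure mdeg g))).
rewrite !mulr_suml raddf_sum [RHS]big_mkcond; apply: eq_bigr => i _ /=.
have hi : part i * P \is (i + d).-homog by rewrite dhomogM // pihomogP.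
case: eqP => [<-|/eqP ne]; first exact: pihomog_dE.
exact: pihomog_ne0 hi.
Qed.

Lemma mmap_diag (F K : fieldType) (iota : {rmorphism F -> K}) (n : nat)
    (x : 'I_n -> K) (a : 'I_n -> F) :
  mmap iota x (\sum_k a k *: 'X_k ^+ 2) = \sum_k iota (a k) * x k ^+ 2.
Proof.
rewrite (raddf_sum (mmap iota x)); apply: eq_bigr => k _ /=.
by rewrite mmapZ rmorphXn /= mmapX mmap1U.
Qed.

(** * Second-order expansion at a point *)

Section Taylor.
Variables (F K : fieldType) (iota : {rmorphism F -> K}) (n : nat) (x : 'I_n -> K).
Hypothesis K2 : 2%N \in [pchar K].

(* Evaluation at the point x + eps e_i, where eps = 'X. *)
Definition taylor (i : 'I_n) : {mpoly F[n]} -> {poly K} :=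
  mmap (polyC \o iota) (fun k => (x k)%:P + (k == i)%:R *: 'X).

HB.instance Definition _ i := GRing.RMorphism.on (taylor i).

Lemma taylorZ i a f : taylor i (a *: f) = iota a *: taylor i f.
Proof. by rewrite /taylor mmapZ /= mul_polyC. Qed.

Lemma coef0_taylor i f : (taylor i f)`_0 = mmap iota x f.
Proof.
rewrite -horner_coef0 -[LHS]/(horner_eval 0 (taylor i f)) /taylor /mmap.
rewrite raddf_sum; apply: eq_bigr => m _ /=; rewrite rmorphM /= /mmap1 rmorph_prod.
congr (_ * _); first by rewrite /horner_eval hornerC.
by apply: eq_bigr => k _; rewrite rmorphXn /= /horner_eval !hornerE.
Qed.

Lemma coef2_sqr (u : {poly K}) : (u ^+ 2)`_2 = u`_1 ^+ 2.
Proof.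
rewrite expr2 coefM !big_ord_recr big_ord0 /= add0r.
by rewrite [u`_2 * _]mulrC addrAC addrr_pchar2 // add0r.
Qed.

(** Squaring leaves no mixed term. At a zero x only a_i eps^2 remains, so in a multiple g P the
    coefficient of eps^2 involves g only through g(x). *)
Lemma taylor_diag (a : 'I_n -> F) i :
  taylor i (\sum_k a k *: 'X_k ^+ 2) =
  (mmap iota x (\sum_k a k *: 'X_k ^+ 2))%:P + iota (a i) *: 'X^2.
Proof.
have P2 : 2%N \in [pchar {poly K}] by rewrite pchar_lalg.
have tX k : taylor i 'X_k ^+ 2 = (x k ^+ 2)%:P + (k == i)%:R *: 'X^2.
  rewrite /taylor mmapX mmap1U sqrD_pchar2 // polyCM -expr2; congr (_ + _).
  by rewrite exprZn; case: eqP; rewrite ?expr1n ?expr0n.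
rewrite mmap_diag !raddf_sum /= (bigD1 i) //= [in RHS](bigD1 i) //=.
rewrite taylorZ rmorphXn /= tX eqxx scale1r scalerDr -mul_polyC -polyCM.
rewrite -!addrA; congr (_ + _); rewrite [RHS]addrC; congr (_ + _).
apply: eq_bigr => k /negPf ki; rewrite taylorZ rmorphXn /= tX ki scale0r addr0.
by rewrite -mul_polyC -polyCM.
Qed.

(* Compare the coefficients of eps ^ 2 at x + eps e_i. *)
Lemma taylor_relation l (a : 'I_n -> F) (b : 'I_l -> F) (h : 'I_l -> {mpoly F[n]}) g :
  \sum_j b j *: h j ^+ 2 = g * (\sum_k a k *: 'X_k ^+ 2) ->
  mmap iota x (\sum_k a k *: 'X_k ^+ 2) = 0 ->
  forall i, \sum_j iota (b j) * (taylor i (h j))`_1 ^+ 2 =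
    mmap iota x g * iota (a i).
Proof.
move=> hg Px i; have /(congr1 (fun u : {poly K} => u`_2)) := congr1 (taylor i) hg.
rewrite rmorphM /= taylor_diag Px add0r -scalerAr coefZ coefMXn /= coef0_taylor.
rewrite mulrC => <-; rewrite raddf_sum coef_sum; apply: eq_bigr => j _ /=.
by rewrite taylorZ rmorphXn coefZ /= coef2_sqr.
Qed.

End Taylor.

(** * Quasilinear forms, subforms and scalar extension *)

Lemma quasilinear0 (F : fieldType) (V : vectType F) (q : V -> F) :
  quasilinear q -> q 0 = 0.
Proof. by move=> [_ qZ]; rewrite -(scale0r (0 : V)) qZ expr0n mul0r. Qed.

Lemma quasilinear_comp (F : fieldType) (V W : vectType F) (f : {linear V -> W})
    (q : W -> F) : quasilinear q -> quasilinear (q \o f).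
Proof.
move=> [qD qZ]; split=> [u v|a v] /=; first by rewrite linearD qD.
by rewrite linearZ qZ.
Qed.

Lemma quasilinear_anisotropic_part (F : fieldType) (V W : vectType F)
    (phi : V -> F) (psi : W -> F) :
  quasilinear phi -> anisotropic_part phi psi -> quasilinear psi.
Proof.
move=> [phiD phiZ] [pi [pi_onto _ psi_pi]].
split=> [w w'|a w]; have [v <-] := pi_onto w.
  by have [v' <-] := pi_onto w'; rewrite -linearD !psi_pi phiD.
by rewrite -linearZ !psi_pi phiZ.
Qed.

(** Since q is additive, any linear complement of the image of f is an orthogonal one. *)
Lemma subform_comp (F : fieldType) (V W : vectType F) (f : {linear V -> W})
    (q : W -> F) : quasilinear q -> injective f -> subform (q \o f) q.
Proof.
move=> qq f_inj; pose U := limg (linfun f); pose C := (U^C)%VS.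
exists (subvs_of C), (q \o vsval); split; first exact: quasilinear_comp.
pose g (x : V * subvs_of C) : W := f x.1 + vsval x.2.
have g_lin : linear g.
  by move=> a x y; rewrite /g !linearP scalerDr addrACA.
pose gL := GRing.isLinear.Build F _ W _ g g_lin.
pose G : {linear (V * subvs_of C)%type -> W} := HB.pack g gL.
have ker_G : lker (linfun G) == 0%VS.
  rewrite -subv0; apply/subvP => -[v w]; rewrite memv_ker lfunE memv0 /= /g /=.
  rewrite addr_eq0 => /eqP fvw.
  have : f v \in (U :&: C)%VS.
    rewrite memv_cap -{1}(lfunE f) memv_img ?memvf //=.
    by rewrite fvw memvN subvsP.
  rewrite capv_compl memv0 => /eqP fv0.
  have -> : v = 0 by apply: f_inj; rewrite fv0 linear0.
  rewrite xpair_eqE eqxx; apply/eqP/val_inj/eqP => /=.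
  by rewrite -oppr_eq0 -fvw fv0.
have im_G w : w \in limg (linfun G).
  have : w \in (U + C)%VS by rewrite addv_complf memvf.
  case/memv_addP => u /memv_imgP[v _ ->] [c cC ->].
  have -> : linfun f v + c = linfun G (v, vsproj C c).
    by rewrite !lfunE /= /g /= vsprojK.
  by rewrite memv_img ?memvf.
(* [subform] asks for an isometry from the whole form to the sum, hence the inverse of G. *)
exists (linfun G)^-1%VF; split.
  exists (linfun G); [move=> w; exact: limg_lfunVK | exact: lker0_lfunK].
move=> w; have {2}<- := limg_lfunVK (im_G w).
rewrite lfunE /= /g /orth_sum; case: qq => -> _ //.
Qed.

Lemma quasilinear_base_change (F K : fieldType) (iota : {rmorphism F -> K})
    (V : vectType F) (q : V -> F) :
  2%N \in [pchar K] -> quasilinear (base_change iota q).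
Proof.
move=> K2; split=> [u v|a v]; rewrite /base_change.
  by rewrite -big_split; apply: eq_bigr => i _; rewrite mxE sqrD_pchar2 // mulrDr.
by rewrite mulr_sumr; apply: eq_bigr => i _; rewrite mxE exprMn mulrCA.
Qed.

(** A nontrivial relation would give the coordinates of an isotropic vector. *)
Lemma ql_coef_free (F : fieldType) (V : vectType F) (q : V -> F) :
  quasilinear q -> anisotropic q ->
  forall s, \sum_j ql_coef q j * s j ^+ 2 = 0 -> forall j, s j = 0.
Proof.
move=> qq q_an s s0 j; pose v := \sum_(i < \dim {:V}) s i *: (vbasis {:V})`_i.
have vs i : coord (vbasis {:V}) i v = s i.
  by rewrite coord_sum_free // (basis_free (vbasisP _)).
have [v0|v0] := eqVneq v 0; first by rewrite -vs v0 linear0.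
case: q_an; exists v => //; rewrite ql_coefE // -[RHS]s0.
by apply: eq_bigr => i _; rewrite vs.
Qed.

Lemma ql_poly_homog (F : fieldType) (V : vectType F) (q : V -> F) :
  ql_poly q \is 2.-homog.
Proof.
by apply: rpred_sum => i _; rewrite rpredZ // (dhomogMn (d := 1)) // dhomogX /= mdeg1.
Qed.

Lemma ql_poly_neq0 (F : fieldType) (V : vectType F) (q : V -> F) :
  quasilinear q -> anisotropic q -> (0 < \dim {:V})%N -> ql_poly q != 0.
Proof.
move=> qq q_an V_gt0; pose i0 := Ordinal V_gt0.
apply/eqP => P0; have /eqP[] := oner_neq0 F.
(* If the polynomial were 0, its value at (1, ..., 1) would be a relation with all s_j = 1. *)
apply: (ql_coef_free qq q_an (s := fun=> 1) _ i0).
have := mmap_diag idfun (fun=> 1) (ql_coef q); rewrite -/(ql_poly q) P0 mmap0.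
by move=> <-.
Qed.

(** * The function field and the multiplier c *)

Lemma function_field_point (F K : fieldType) (iota : {rmorphism F -> K})
    (n : nat) (x : 'I_n -> K) (m : nat) (z : 'I_m -> K) :
  (forall y : K, exists (d : nat) (f g : {mpoly F[n]}),
    [/\ f \is d.-homog, g \is d.-homog, mmap iota x g != 0
      & y = mmap iota x f / mmap iota x g]) ->
  exists (d : nat) (h : 'I_m -> {mpoly F[n]}) (t : K),
    [/\ forall j, h j \is d.-homog, t != 0
      & forall j, mmap iota x (h j) = z j * t].
Proof.
move=> onto.
have [d /fin_all_exists[f /fin_all_exists[g fgP]]] :=
  fin_all_exists (fun j => onto (z j)).
(* Multiply by the product of all denominators; f_j takes the place of g_j, which has the same
   degree, so all degrees agree. *)
exists (\sum_j d j)%N, (fun j => f j * \prod_(k | k != j) g k).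
exists (\prod_j mmap iota x (g j)); split=> [j||j].
- have [fj _ _ _] := fgP j; rewrite [X in X.-homog](bigD1 j) //=.
  apply: dhomogM => //.
  apply: (big_ind2 (fun u e => u \is e.-homog)) => [|u e v e'|k _].
  + exact: dhomog1.
  + exact: dhomogM.
  + by have [] := fgP k.
- by apply/prodf_neq0 => j _; have [] := fgP j.
- have [_ _ gj0 ->] := fgP j; rewrite rmorphM rmorph_prod /= [in RHS](bigD1 j) //=.
  by rewrite mulrA divfK.
Qed.

Lemma multiplier_exists (F K : fieldType) (iota : {rmorphism F -> K})
    (V W : vectType F) (p : V -> F) (q : W -> F) :
  2%N \in [pchar F] -> quasilinear q -> anisotropic q -> ql_poly p != 0 ->
  is_function_field (ql_poly p) iota -> isotropic (base_change iota q) ->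
  exists2 c : K, c != 0
    & exists T : {linear 'rV[K]_(\dim {:V}) -> 'rV[K]_(\dim {:W})},
        forall e, base_change iota q (T e) = c * base_change iota p e.
Proof.
move=> F2 qq q_an P0 [x [_ vanish onto]] [z z0 qz].
have K2 : 2%N \in [pchar K] by rewrite (rmorph_pchar iota).
set P := ql_poly p in P0 vanish.
have [d [h [t [h_homog t0 hx]]]] := function_field_point (fun j => z 0 j) onto.
pose G := \sum_j ql_coef q j *: h j ^+ 2.
have G_homog : G \is (d * 2).-homog.
  by apply: rpred_sum => j _; rewrite rpredZ // dhomogMn.
have Gx : mmap iota x G = 0.
  transitivity (t ^+ 2 * base_change iota q z); last by rewrite qz mulr0.
  rewrite (raddf_sum (mmap iota x)) mulr_sumr.
  apply: eq_bigr => j _ /=; rewrite mmapZ rmorphXn /= hx exprMn.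
  by rewrite [RHS]mulrC mulrA.
have P_homog : P \is 2.-homog by apply: ql_poly_homog.
(* This cofactor need not be homogeneous; a homogeneous g is chosen so that [vanish] also applies to
   it. *)
have [g' Gg'] := (vanish _ _ G_homog).1 Gx.
rewrite Gg' in G_homog.
have [g g_homog gg'] := homog_divisor P_homog G_homog.
have Gg : G = g * P by rewrite Gg'.
have Px : mmap iota x P = 0.
  by apply/(vanish _ _ P_homog); exists 1; rewrite mul1r.
exists (mmap iota x g).
  apply/eqP => gx0; have [k gk] := (vanish _ _ g_homog).1 gx0.
  have GP2 : G = P ^+ 2 * k by rewrite Gg gk -mulrA -expr2 mulrC.
  have h_dvd := sqr_dvd_diag F2 (ql_coef_free qq q_an) P0 GP2.
  case/eqP: z0; apply/rowP => j; rewrite mxE; apply/eqP.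
  (* Since P(x) = 0, evaluating at x gives (z_j t)^2 = 0, hence z_j = 0 for every j. *)
  have [r /(congr1 (mmap iota x))] := h_dvd j.
  rewrite [RHS]rmorphM !rmorphXn /= Px expr0n mul0r hx => /eqP.
  by rewrite expf_eq0 mulf_eq0 (negPf t0) orbF.
exists (mulmxr (\matrix_(i, j) (taylor iota x i (h j))`_1)) => e.
rewrite /base_change mulr_sumr /=.
(* Additivity of squaring reduces the identity to the basis vectors e_i, where it is
   [taylor_relation]. *)
transitivity (\sum_j \sum_i
    iota (ql_coef q j) * (e 0 i * (taylor iota x i (h j))`_1) ^+ 2).
  apply: eq_bigr => j _; rewrite mxE sqr_sum_pchar2 // mulr_sumr.
  by apply: eq_bigr => i _; rewrite mxE.
rewrite exchange_big; apply: eq_bigr => i _ /=.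
rewrite mulrA -(taylor_relation K2 Gg Px) mulr_suml.
by apply: eq_bigr => j _; rewrite exprMn mulrA mulrAC.
Qed.

Theorem theorem6p14 (F : fieldType) (V W : vectType F)
    (p : V -> F) (q : W -> F)
    (K : fieldType) (iota : {rmorphism F -> K})
    (V1 W1 : vectType K) (p1 : V1 -> K) (q1 : W1 -> K) :
  2%N \in [pchar F] ->
  quasilinear p -> anisotropic p -> (2 <= \dim {:V})%N ->
  quasilinear q -> anisotropic q -> (2 <= \dim {:W})%N ->
  is_function_field (ql_poly p) iota ->
  isotropic (base_change iota q) ->
  anisotropic_part (base_change iota p) p1 ->
  anisotropic_part (base_change iota q) q1 ->
  exists (U : vectType K) (rho : U -> K),
    [/\ quasilinear rho, subform rho q1 & similar_forms p1 rho].
Proof.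
move=> F2 pq p_an V2 qq q_an _ K_ff q_iso p1P q1P.
have K2 : 2%N \in [pchar K] by rewrite (rmorph_pchar iota).
have P0 : ql_poly p != 0 by apply: ql_poly_neq0 => //; apply: ltnW.
have [c c0 [T qT]] := multiplier_exists F2 qq q_an P0 K_ff q_iso.
have q1q : quasilinear q1.
  exact: quasilinear_anisotropic_part (quasilinear_base_change iota q K2) q1P.
have [pi [pi_onto pi0 p1_pi]] := p1P; have [sg [_ _ q1_sg]] := q1P.
(* A linear section of [pi]; lifting through it avoids having to pass T to the quotients. *)
pose s : 'Hom(V1, _) := ((linfun pi)^-1)%VF.
have piK v : pi (s v) = v.
  rewrite -[pi _]lfunE /=; apply: limg_lfunVK.
  by have [u <-] := pi_onto v; rewrite -[pi u]lfunE memv_img ?memvf.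
pose f : {linear V1 -> W1} := sg \o T \o s.
have q1f v : q1 (f v) = c * p1 v by rewrite /= q1_sg qT -p1_pi piK.
(* If f v = 0, then c p_1(v) = 0, so the lift [s v] is isotropic or zero and [pi] sends it to v =
   0. *)
have f_inj : injective f.
  apply: raddf_inj => v fv0; rewrite -(piK v); apply/pi0.
  apply: (mulfI c0); rewrite mulr0 -p1_pi piK -q1f fv0.
  exact: quasilinear0.
exists V1, (q1 \o f); split.
- exact: quasilinear_comp.
- exact: subform_comp.
(* The form [q1 \o f] equals c p_1, so p_1 is its multiple by c^-1. *)
- exists c^-1; first by rewrite invr_eq0.
  exists idfun; split; first by exists id.
  by move=> v; rewrite /comp q1f mulKf.
Qed.
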